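(* Let $X$ be an asymmetrically normed space with conjugate space $\bar X$, let $f:X\to\overline{\mathbb{R}}$ be a proper function, $x\in X$ and $\phi\in\bar X^*$. Set $g=f-\phi$ and consider the following statements: (i) $f$ is weakly lower semicontinuous at $x$ (with respect to the weak topology of $X$), and $f^*:\bar X^*\to\overline{\mathbb{R}}$ is right Gâteaux differentiable at $\phi$ with $Df^*(\phi)=x$ (i.e. $Df^*(\phi)$ is the evaluation map $\psi\mapsto\psi(x)$ on $\bar X^*$). Moreover, there exists a sequence $(y_n)_{n\in\mathbb{N}}$ in $X$ such that $\lim_{n\to\infty}g(y_n)=\inf g(X)$ and $y_n$ converges to $x$ weakly in $X$. (ii) $g(x)=\inf g(X)$, and for every sequence $(y_n)_{n\in\mathbb{N}}$ in $X$: if $\lim_{n\to\infty}g(y_n)=g(x)$, then $y_n$ converges to $x$ weakly in $\bar X$. (iii) $f(x)\in\mathbb{R}$ and $f^{**}(x)=f(x)$. Then (i) $\implies$ (ii) $\implies$ (iii). Moreover, if $f$ is convex, then (i) $\iff$ (ii).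
   Context: An asymmetric norm on a real vector space $X$ is a function $p=\Vert\cdot\Vert_X:X\to\mathbb{R}_{\ge0}$ such that for all $r\ge0$ and $x,y\in X$: $x=0\iff p(x)=p(-x)=0$; $p(rx)=rp(x)$; $p(x+y)\le p(x)+p(y)$. The pair $(X,p)$ is an asymmetrically normed space. Its topology has at each $x\in X$ the neighbourhood basis $B_r(x)=\{y\in X: p(y-x)<r\}$, $r>0$. The conjugate space is $\bar X=(X,\bar p)$ with $\bar p(x)=p(-x)$, again an asymmetrically normed space. The dual cone $X^*$ is the set of all linear $\phi:X\to\mathbb{R}$ that are upper semicontinuous on $X$; equivalently, those for which there is $C\ge0$ with $\phi(x)\le C\Vert x\Vert_X$ for all $x\in X$. It is closed under sums and multiplication by non-negative scalars and carries the functional $\Vert\phi\Vert_{X^*}=\sup_{x\in B_1(0)}\phi(x)$, which makes it a normed cone. $\bar X^*$ denotes the dual cone of $\bar X$; one has $\bar X^*=-X^*$. The topology of $\bar X^*$ has at each $\phi\in\bar X^*$ the neighbourhood basis $\{\phi+\psi:\psi\in\bar X^*,\ \Vert\psi\Vert_{\bar X^*}<r\}$, $r>0$. Weak convergence: a sequence $(x_n)$ converges weakly to $x$ in $X$ if $\limsup_{n\to\infty}\psi(x_n-x)\le0$ for all $\psi\in X^*$; it converges weakly to $x$ in $\bar X$ if the same holds for all $\psi\in\bar X^*$. This is convergence in the weak topology of $X$ (resp. $\bar X$), whose neighbourhood basis at $x$ consists of the sets $\{z\in X:\psi_i(z-x)<\epsilon,\ i=1,\dots,k\}$ with $k\in\mathbb{N}$,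 $\epsilon>0$ and $\psi_1,\dots,\psi_k\in X^*$ (resp. $\bar X^*$). $\overline{\mathbb{R}}=\{-\infty\}\cup\mathbb{R}\cup\{\infty\}$. A function $f:X\to\overline{\mathbb{R}}$ is convex if its epigraph $\{(x,t)\in X\times\mathbb{R}:f(x)\le t\}$ is convex, and proper if it never takes the value $-\infty$ and is not identically $\infty$. For $f:X\to\overline{\mathbb{R}}$, the convex conjugate $f^*:\bar X^*\to\overline{\mathbb{R}}$ is $f^*(\phi)=\sup_{y\in X}[\phi(y)-f(y)]$. For $k:\bar X^*\to\overline{\mathbb{R}}$, the conjugate $k^*:X\to\overline{\mathbb{R}}$ is $k^*(x)=\sup_{\phi\in\bar X^*}[\phi(x)-k(\phi)]$. Thus $f^{**}=(f^* )^*:X\to\overline{\mathbb{R}}$. A function $F:Y\to\overline{\mathbb{R}}$ on a normed cone $Y$ (here $Y=\bar X^*$) is right Gâteaux differentiable at $u\in Y$ if $F(u)\in\mathbb{R}$ and there is a continuous map $L:Y\to\mathbb{R}$, linear with respect to linear combinations with non-negative scalars, such that $\lim_{t\searrow0}\frac1t[F(u+tv)-F(u)-tL(v)]=0$ for all $v\in Y$; then $DF(u):=L$. A point $x\in X$ is identified with its evaluation map $\psi\mapsto\psi(x)$ on $\bar X^*$, which is continuous. *)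

(* Defs.v *)
From HB Require Import structures.
From mathcomp Require Import all_boot all_order all_algebra.
From mathcomp Require Import all_classical all_reals all_analysis.
From mathcomp Require Import ring lra.

Set Implicit Arguments.
Unset Strict Implicit.
Unset Printing Implicit Defensive.

Import Order.TTheory GRing.Theory Num.Theory.
Import numFieldNormedType.Exports.

Local Open Scope classical_set_scope.
Local Open Scope ring_scope.

Section AsymmetricNorm.
Context {R : realType} {X : lmodType R}.
Implicit Types (p : X -> R) (x y z : X) (phi psi : X -> R).

Record asymmetric_norm p : Prop := AsymmetricNorm {
  asym_ge0 : forall x, 0 <= p x ;
  asym_eq0 : forall x, x = 0 <-> p x = 0 /\ p (- x) = 0 ;
  asymZ : forall (r : R) x, 0 <= r -> p (r *: x) = r * p x ;
  asymD : forall x y, p (x + y) <= p x + p y }.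

Definition conj_norm p : X -> R := fun x => p (- x).

Definition asym_ball p x (r : R) : set X := [set y | p (y - x) < r].

Definition asym_nbhs p x : set_system X :=
  filter_from [set r : R | 0 < r] (asym_ball p x).

Definition upper_semicontinuous p phi : Prop :=
  forall x (a : R), phi x < a -> \forall y \near asym_nbhs p x, phi y < a.

(* The dual cone consists of genuine functions; the vector space operations on
   it are the pointwise ones. Maps on the dual cone are represented by maps on
   all of [X -> R], of which only the values on the cone are ever used. *)
Definition dual_cone p : set (X -> R) :=
  [set phi | scalar phi /\ upper_semicontinuous p phi].

Definition dual_norm p phi : \bar R :=
  ereal_sup [set (phi x)%:E | x in asym_ball p 0 1].

Definition dual_nbhs p phi : set_system (X -> R) :=
  filter_from [set r : R | 0 < r] (fun r =>
    [set phi \+ psi | psi in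
      [set psi | dual_cone p psi /\ (dual_norm p psi < r%:E)%E]]).

Definition weak_cvg p (y : nat -> X) x : Prop :=
  forall psi, dual_cone p psi ->
    (limn_esup (fun n => (psi (y n - x))%:E) <= 0)%E.

Definition weak_nbhs p x : set_system X :=
  [set U | exists (k : nat) (psi : 'I_k -> X -> R) (e : R),
    [/\ 0 < e, forall i, dual_cone p (psi i) &
        [set z | forall i, psi i (z - x) < e] `<=` U]].

Definition weakly_lsc_at p (f : X -> \bar R) x : Prop :=
  forall a : R, (a%:E < f x)%E ->
    \forall z \near weak_nbhs p x, (a%:E < f z)%E.

Definition proper_fun (f : X -> \bar R) : Prop :=
  (forall x, f x != -oo%E) /\ (exists x, f x != +oo%E).

(* [R^o] is [R] seen as a module over itself. *)
Definition convex_ereal (f : X -> \bar R) : Prop :=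
  convex_set ([set xt | (f xt.1 <= xt.2%:E)%E] : set (X * R^o)%type).

Definition convex_conjugate (f : X -> \bar R) : (X -> R) -> \bar R :=
  fun phi => ereal_sup [set ((phi y)%:E - f y)%E | y in [set: X]].

Definition dual_conjugate p (k : (X -> R) -> \bar R) : X -> \bar R :=
  fun x => ereal_sup [set ((phi x)%:E - k phi)%E
                     | phi in dual_cone (conj_norm p)].

Definition biconjugate p (f : X -> \bar R) : X -> \bar R :=
  dual_conjugate p (convex_conjugate f).

Definition cone_linear p (L : (X -> R) -> R) : Prop :=
  forall (a b : R) phi psi, 0 <= a -> 0 <= b ->
    dual_cone p phi -> dual_cone p psi ->
    L ((a \*o phi) \+ (b \*o psi)) = a * L phi + b * L psi.

Definition cone_continuous p (L : (X -> R) -> R) : Prop :=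
  forall phi, dual_cone p phi -> L @ dual_nbhs p phi --> L phi.

(* [F] is right Gateaux differentiable at [u] on the dual cone of [p], and
   [DF(u) = L]. The values [F (u + t v)] may be infinite, so the limit is taken
   in the extended reals. *)
Definition right_gateaux p (F : (X -> R) -> \bar R) (u : X -> R)
    (L : (X -> R) -> R) : Prop :=
  [/\ F u \is a fin_num, cone_linear p L, cone_continuous p L &
      forall v, dual_cone p v ->
        ((t^-1)%:E * (F (u \+ (t \*o v))%R - F u - (t * L v)%:E))%E
          @[t --> 0^'+] --> 0%E].

Lemma asymmetric_norm_conj p : asymmetric_norm p -> asymmetric_norm (conj_norm p).
Proof.
move=> [p0 pe pZ pD]; split => [x|x|r x r0|x y]; rewrite /conj_norm.
- exact: p0.
- by rewrite opprK pe and_comm.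
- by rewrite -scalerN pZ.
- by rewrite opprD pD.
Qed.

Lemma dual_coneP p phi : asymmetric_norm p ->
  dual_cone p phi <->
  scalar phi /\ exists2 C : R, 0 <= C & forall x, phi x <= C * p x.
Proof.
move=> [p0 pe pZ pD]; split=> [[phil phiu]|[phil [C C0 phiC]]]; split=> //.
- have phi0 : phi 0 = 0.
    by have := phil (-1) 0 0; rewrite scaler0 addr0 mulN1r addrC subrr.
  have phiZ (a : R) z : phi (a *: z) = a * phi z.
    by have := phil a z 0; rewrite addr0 phi0 addr0.
  have [|r /= r0 rphi] := phiu 0 1; first by rewrite phi0.
  exists (2 / r); first by rewrite divr_ge0// ltW.
  move=> x; apply/ler_addgt0Pr => e e0.
  pose d := p x + e * r / 2.
  have d0 : 0 < d by rewrite ltr_wpDl// ?divr_gt0// mulr_gt0.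
  have : phi ((r / (2 * d)) *: x) < 1.
    apply: rphi; rewrite /asym_ball /= subr0 pZ; last first.
      by rewrite divr_ge0// ?mulr_ge0// ltW.
    rewrite mulrAC ltr_pdivrMr ?mulr_gt0// ltr_pM2l//.
    have := p0 x; have := mulr_gt0 e0 r0; rewrite /d; lra.
  rewrite phiZ mulrAC ltr_pdivrMr ?mulr_gt0// mul1r => H.
  have -> : 2 / r * p x + e = (2 * d) / r by rewrite /d; field; rewrite gt_eqF.
  by rewrite ler_pdivlMr// mulrC ltW.
- move=> x a xa.
  have phiB y z : phi (y - z) = phi y - phi z.
    by rewrite addrC -scaleN1r phil mulN1r addrC.
  exists ((a - phi x) / (C + 1)).
    by rewrite /= divr_gt0 ?subr_gt0// ltr_wpDl.
  move=> y /=; rewrite /asym_ball /= ltr_pdivlMr; last lra; move=> H.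
  rewrite -(ltrD2r (- phi x)) -phiB (le_lt_trans (phiC _))//.
  by rewrite (le_lt_trans _ H)// mulrC ler_wpM2l// lerDl.
Qed.

Lemma weak_cvgP p (y : nat -> X) x :
  weak_cvg p y x <-> y @ \oo --> weak_nbhs p x.
Proof.
split=> [yx U [k [psi [e [e0 psip eU]]]]|yx psi psip].
- have H i : \forall n \near \oo, psi i (y n - x) < e.
    have : (limn_esup (fun n => (psi i (y n - x))%:E) < e%:E)%E.
      by rewrite (le_lt_trans (yx _ (psip i)))// lte_fin.
    move=> /ereal_inf_lt[_ [V Voo <-]] Ve.
    apply: filterS Voo => n Vn; rewrite -lte_fin (le_lt_trans _ Ve)//.
    by apply: ereal_sup_ubound; exists n.
  have : \forall n \near \oo, forall i, psi i (y n - x) < e.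
    exact: filter_forall.
  by apply: filterS => n yn; apply: eU.
- apply/lee_addgt0Pr => e e0; rewrite add0e.
  have /yx Voo : weak_nbhs p x [set z | psi (z - x) < e].
    exists 1%N, (fun=> psi), e; split=> // z /= /(_ ord0); exact.
  apply: (@le_trans _ _ (ereal_sup
      [set (psi (y n - x))%:E | n in [set n | psi (y n - x) < e]])).
    by apply: ereal_inf_lbound; exists [set n | psi (y n - x) < e].
  by apply: ge_ereal_sup => _ [n /= ne <-]; rewrite lee_fin ltW.
Qed.

End AsymmetricNorm.

(* Main.v *)
Require Import Defs.
From HB Require Import structures.
From mathcomp Require Import all_boot all_order all_algebra.
From mathcomp Require Import all_classical all_reals all_analysis.
From mathcomp Require Import ring lra.

Set Implicit Arguments.
Unset Strict Implicit.
Unset Printing Implicit Defensive.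

Import Order.TTheory GRing.Theory Num.Theory.
Import numFieldNormedType.Exports.

Local Open Scope classical_set_scope.
Local Open Scope ring_scope.

(** Since [f^* phi = - inf g], the Young inequality at [phi + t v] says that
    [t * v y <= f^* (phi + t v) - f^* phi + (g y - inf g)] for every [y].

    (i) implies (ii). Divide the inequality by a small fixed [t] at which the
    difference quotient of [f^*] is close to [v x], and let [y] run along a
    minimizing sequence: [v (y n)] is eventually at most [v x] up to an
    arbitrary error. So every minimizing sequence converges to [x] weakly in the
    conjugate space ([minimizing_seq_weak_cvg]). It remains to see that [x] is a
    minimizer. Weak lower semicontinuity of [f] does not pass to [g = f - phi],
    because [- phi] is weakly upper semicontinuous for the topology of [X]; but
    along the given sequence, which converges weakly for both topologies, the
    values of [phi] converge to [phi x], and that suffices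
    ([weakly_lsc_min_attained]).

    (ii) implies (iii). As [x] minimizes [g], the single functional [phi]
    already attains [f x] in the supremum that defines the biconjugate.

    (ii) implies (i) for convex [f]. The inequality [f z >= f x + phi (z - x)]
    gives weak lower semicontinuity at [x], and the constant sequence [x] is
    minimizing. For the derivative, the sequential hypothesis is first turned
    into a uniform one: for every [e > 0] there is [d > 0] such that
    [g z <= g x + d] forces [v (z - x) < e] ([minimizing_seq_unif]). Convexity
    along the segment from [x] to [y] propagates this to the growth condition
    [t * (v (y - x) - e) <= g y - g x] for all [y], as soon as [t * e <= d],
    which is the upper bound [f^* (phi + t v) <= f^* phi + t (v x + e)]
    ([conjugate_le_of_strong_min]). The matching lower bound, with [e = 0], is
    the Young inequality at [x]. *)

(** * Dual cones and weak convergence *)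

Section Functionals.
Variables (R : realType) (X : lmodType R).
Implicit Types (p : X -> R) (x y z : X) (phi psi : X -> R).

Lemma scalar0 psi : scalar psi -> psi 0 = 0.
Proof.
by move=> l; have := l (-1) 0 0; rewrite scaler0 addr0 mulN1r addrC subrr.
Qed.

Lemma scalar_homog psi : scalar psi -> forall a u, psi (a *: u) = a * psi u.
Proof. by move=> l a u; have := l a u 0; rewrite (scalar0 l) !addr0. Qed.

Lemma scalar_sub psi : scalar psi -> forall u v, psi (u - v) = psi u - psi v.
Proof. by move=> l u v; rewrite addrC -scaleN1r l mulN1r addrC. Qed.

Lemma dual_coneN p phi : asymmetric_norm p -> dual_cone (conj_norm p) phi ->
  dual_cone p (fun z => - phi z).
Proof.
move=> pn /(dual_coneP phi (asymmetric_norm_conj pn))[l [C C0 phiC]].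
apply/(dual_coneP _ pn); split.
  by move=> a u v; rewrite l opprD mulrN.
exists C => // u; have := phiC (- u).
by rewrite /conj_norm opprK -[- u]sub0r (scalar_sub l) (scalar0 l) sub0r.
Qed.

Lemma weak_cvg_ltP p (y : nat -> X) x : weak_cvg p y x <->
  forall psi, dual_cone p psi -> forall e : R, 0 < e ->
    \forall n \near \oo, psi (y n - x) < e.
Proof.
split=> [/weak_cvgP yx psi psip e e0|H].
  apply: (yx [set z | psi (z - x) < e]).
  by exists 1%N, (fun=> psi), e; split=> // z /= /(_ ord0).
apply/weak_cvgP => U [k [psi [e [e0 psip eU]]]].
have : \forall n \near \oo, forall i, psi i (y n - x) < e.
  by apply: filter_forall => i; apply: H.
by apply: filterS => n yn; apply: eU.
Qed.

(** Since [u / (p u + 1)] lies in the unit ball, the dual norm bounds [psi u]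
    even when [p u = 0]; applied to [x] and [- x] this bounds [psi x] on both
    sides, although the norm of [X] is one-sided. *)
Lemma evaluation_cone_continuous p x : asymmetric_norm p ->
  cone_continuous p (fun psi : X -> R => psi x).
Proof.
move=> pn phi _.
have p0 := asym_ge0 pn.
have bound psi r u : scalar psi -> (dual_norm p psi < r%:E)%E ->
    psi u < r * (p u + 1).
  move=> l /(le_lt_trans _) psir.
  have pu : 0 < p u + 1 by rewrite ltr_wpDl.
  rewrite -ltr_pdivrMr// mulrC -(scalar_homog l) -lte_fin; apply: psir.
  apply: ereal_sup_ubound; exists ((p u + 1)^-1 *: u) => //.
  rewrite /asym_ball /= subr0 (asymZ pn) ?invr_ge0 1?ltW//.
  by rewrite mulrC ltr_pdivrMr// mul1r ltrDl.
have p1 := p0 x; have p2 := p0 (- x).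
set D := p x + p (- x) + 1.
have D0 : 0 < D by rewrite /D; lra.
move=> A /nbhs_ballP[e /= e0 eA].
exists (e / D) => /=; first by rewrite divr_gt0.
move=> _ [psi [[l _] nr] <-] /=; apply: eA; rewrite /ball /=.
have eD : e = e / D * D by field; rewrite gt_eqF.
have eD0 : 0 < e / D by rewrite divr_gt0.
have B1 : psi x < e.
  apply: (lt_le_trans (bound _ _ x l nr)); rewrite {2}eD ler_pM2l// /D; lra.
have B2 : - psi x < e.
  rewrite -sub0r -(scalar0 l) -(scalar_sub l) sub0r.
  apply: (lt_le_trans (bound _ _ (- x) l nr)); rewrite {2}eD ler_pM2l// /D; lra.
by rewrite opprD addNKr ltr_norml; apply/andP; split; lra.
Qed.

End Functionals.

(** * Convex conjugates *)

Section Conjugates.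
Variables (R : realType) (X : lmodType R).
Implicit Types (p : X -> R) (f : X -> \bar R) (x y z : X) (phi psi : X -> R).

Lemma convex_conjugate_ge f psi y :
  ((psi y)%:E - f y <= convex_conjugate f psi)%E.
Proof. by apply: ereal_sup_ubound; exists y. Qed.

Lemma convex_conjugateE f phi : convex_conjugate f phi =
  (- ereal_inf (range (fun z => f z - (phi z)%:E)))%E.
Proof.
rewrite /ereal_inf oppeK /convex_conjugate; congr ereal_sup.
rewrite image_comp; apply: eq_imagel => z _ /=.
by rewrite fin_num_oppeD// EFinN oppeK addeC.
Qed.

Lemma convex_erealP f (s a b : R) u v : convex_ereal f -> 0 <= s <= 1 ->
  (f u <= a%:E)%E -> (f v <= b%:E)%E ->
  (f (s *: u + (1 - s) *: v)%R <= (s * a + (1 - s) * b)%:E)%E.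
Proof.
move=> fc /andP[s0 s1] ua vb.
have := fc (u, a) (v, b) (Itv01 s0 s1).
rewrite !inE /=; exact.
Qed.

Lemma biconjugate_le p f x : f x != -oo%E -> (biconjugate p f x <= f x)%E.
Proof.
move=> fx; apply: ge_ereal_sup => _ [psi _ <-].
have := convex_conjugate_ge f psi x.
case: (f x) fx => [r|_ _|]//; last by rewrite leey.
case: (convex_conjugate f psi) => [c|_|//] _.
- by rewrite -!EFinB !lee_fin; lra.
- by rewrite leNye.
Qed.

End Conjugates.

(** * Minimizing sequences and differentiability of the conjugate *)

(** If no [d] worked, the failures for [d = 1 / (n + 1)] would form a minimizing
    sequence that avoids [P]. *)
Lemma minimizing_seq_unif (R : realType) (T : Type) (h : T -> \bar R) (x0 : T) (P : set T) :
  h x0 \is a fin_num -> (forall z, (h x0 <= h z)%E) ->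
  (forall y : nat -> T, h (y n) @[n --> \oo] --> h x0 ->
    \forall n \near \oo, P (y n)) ->
  exists2 d : R, 0 < d & forall z, (h z <= h x0 + d%:E)%E -> P z.
Proof.
move=> hfin hmin hP; apply: contrapT => nd.
have /choice[y yP] : forall n : nat, exists z,
    (h z <= h x0 + (n.+1%:R^-1)%:E)%E /\ ~ P z.
  move=> n; apply: contrapT => nz; apply: nd.
  exists n.+1%:R^-1 => // z hz; apply: contrapT => nP; apply: nz.
  by exists z.
have hy : h (y n) @[n --> \oo] --> h x0.
  apply: (@squeeze_cvge _ _ _ _ (cst (h x0)) _
      (fun n => h x0 + (n.+1%:R^-1)%:E)%E).
  - by apply: nearW => n /=; rewrite hmin (yP n).1.
  - exact: cvg_cst.
  - rewrite -[X in _ --> X]adde0; apply: cvgeD; first by rewrite fin_num_adde_defl.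
      exact: cvg_cst.
    by apply: cvg_EFin; [exact: nearW | exact: cvg_harmonic].
have [n] := filter_ex (hP y hy).
exact: (yP n).2.
Qed.

Lemma cvge0_of_bounds (R : realType) (T : Type) (F : set_system T)
    (u : T -> \bar R) : Filter F ->
  (forall e : R, 0 < e -> \forall t \near F, (0 <= u t <= e%:E)%E) ->
  u @ F --> 0%E.
Proof.
move=> FF H.
have bounds_fin (e : R) z : (0 <= z <= e%:E)%E -> z \is a fin_num.
  by case: z => [//| |//]; rewrite leye_eq andbF.
apply/fine_cvgP; split; first by apply: filterS (H 1 ltr01) => t /bounds_fin.
apply/cvgrPdist_le => e e0.
apply: filterS (H e e0) => t /= ue; move: (ue).
rewrite -(fineK (bounds_fin _ _ ue)) !lee_fin => /andP[u0 u1].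
by rewrite sub0r normrN ger0_norm.
Qed.

Section Differentiability.
Variables (R : realType) (X : lmodType R).
Implicit Types (p : X -> R) (f : X -> \bar R) (x y z : X) (phi psi v : X -> R).

(** The Young inequality at [phi + t v] bounds [t * v (y n)] by an increment of
    the conjugate plus the defect of [y n] as a minimizer. With [t] fixed so
    that the difference quotient exceeds [v x] by less than [e / 2], it is
    enough that the defect drops below [t * (e / 2)]. *)
Lemma minimizing_seq_weak_cvg p f phi x (y : nat -> X) :
  (forall z, f z != -oo%E) ->
  right_gateaux (conj_norm p) (convex_conjugate f) phi
    (fun psi : X -> R => psi x) ->
  (f (y n) - (phi (y n))%:E)%E @[n --> \oo] -->
    ereal_inf (range (fun z => f z - (phi z)%:E)%E) ->
  weak_cvg (conj_norm p) y x.
Proof.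
move=> fN [Ffin _ _ Fd] gy; apply/weak_cvg_ltP => v vd e e0.
have e20 : 0 < e / 2 by rewrite divr_gt0.
have qlt : \forall t \near 0^'+, ((t^-1)%:E *
    (convex_conjugate f (phi \+ t \*o v)%R - convex_conjugate f phi -
     (t * v x)%:E) < (e / 2)%:E)%E.
  have e2 : (0 < (e / 2)%:E)%E by rewrite lte_fin.
  exact: (Fd v vd _ (open_ereal_lt' e2)).
have [t [tlt t0]] := filter_ex (filterI qlt (nbhs_right_gt (0 : R))).
set c := fine (convex_conjugate f phi).
have Fc : convex_conjugate f phi = c%:E by rewrite /c fineK.
rewrite Fc in tlt.
have infE : ereal_inf (range (fun z => f z - (phi z)%:E)%E) = (- c)%:E.
  by rewrite -[LHS]oppeK -convex_conjugateE Fc.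
rewrite infE in gy.
have te0 : 0 < t * (e / 2) by rewrite mulr_gt0.
have gc : ((- c)%:E < (- c + t * (e / 2))%:E)%E by rewrite lte_fin ltrDl.
have near_inf : \forall n \near \oo,
    (f (y n) - (phi (y n))%:E < (- c + t * (e / 2))%:E)%E.
  exact: (gy _ (open_ereal_lt' gc)).
apply: filterS near_inf => n /=.
have := convex_conjugate_ge f (phi \+ t \*o v) (y n).
move: tlt (fN (y n)).
case: (convex_conjugate f _) => [a||]; last 2 first.
(* The value +oo at phi + t v contradicts the bound on the quotient. *)
- by rewrite -[X in (_ * X < _)%E]/(+oo%E : \bar R) gt0_muley ?lte_fin ?invr_gt0.
- by move=> _; case: (f (y n)).
case: (f (y n)) => [r||]//= + _.
move=> at_lt ra rc.
have {}at_lt : t^-1 * (a - c - t * v x) < e / 2 by rewrite -lte_fin.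
have {}ra : phi (y n) + t * v (y n) - r <= a by rewrite -lee_fin.
have {}rc : r - phi (y n) < - c + t * (e / 2) by rewrite -lte_fin.
rewrite mulrC ltr_pdivrMr// in at_lt.
rewrite (scalar_sub vd.1) ltrBlDr -(ltr_pM2l t0); lra.
Qed.

(** The claim unfolds to [t * (v (y - x) - e) <= g y - g x] for all [y], where
    [g = f - phi]. It is clear when [v (y - x) < e]. Otherwise the point [z] of
    the segment from [x] to [y] with [v (z - x) = e] exactly must satisfy
    [g z - g x > d]; as [g z - g x] is at most the fraction [e / v (y - x)] of
    [g y - g x] by convexity, [g y - g x] grows at least linearly in
    [v (y - x)], with slope [d / e >= t]. *)
Lemma conjugate_le_of_strong_min f phi v x (c d e t : R) :
  convex_ereal f -> scalar phi -> scalar v -> f x = c%:E ->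
  (forall z, (f x - (phi x)%:E <= f z - (phi z)%:E)%E) ->
  0 < d -> 0 < e ->
  (forall z, (f z - (phi z)%:E <= f x - (phi x)%:E + d%:E)%E -> v (z - x) < e) ->
  0 <= t -> t * e <= d ->
  (convex_conjugate f (phi \+ t \*o v)%R <= (phi x - c + t * (v x + e))%:E)%E.
Proof.
move=> fc lphi lv fx fmin d0 e0 small t0 ted.
apply: ge_ereal_sup => _ [y _ <-] /=.
case fy: (f y) => [r||]; last 2 first.
- exact: leNye.
- by have := fmin y; rewrite fx fy.
have rho0 : c - phi x <= r - phi y.
  by have := fmin y; rewrite fx fy -lee_fin.
rewrite -EFinB lee_fin.
set rho := r - phi y - (c - phi x); have {}rho0 : 0 <= rho by rewrite subr_ge0.
set w := v y - v x.
suff : t * (w - e) <= rho by rewrite /w /rho; lra.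
have [we|we] := ltP w e.
  by apply: le_trans rho0; rewrite mulr_ge0_le0// subr_le0 ltW.
have w0 : 0 < w by exact: lt_le_trans we.
set s := e / w.
have s0 : 0 < s by rewrite divr_gt0.
have s1 : s <= 1 by rewrite ler_pdivrMr ?mul1r.
have sw : s * w = e by rewrite /s; field; rewrite gt_eqF.
set z := s *: y + (1 - s) *: x.
have fz : (f z <= (s * r + (1 - s) * c)%:E)%E.
  by apply: convex_erealP; rewrite ?fy ?fx// (ltW s0).
have zE psi : scalar psi -> psi z = s * psi y + (1 - s) * psi x.
  by move=> l; rewrite l (scalar_homog l).
have vz : v (z - x) = e by rewrite (scalar_sub lv) zE// -sw /w; ring.
have d_lt : d < s * rho.
  rewrite ltNge; apply/negP => srho.
  have : v (z - x) < e.
    apply: small; apply: (le_trans (leeD2r _ fz)).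
    rewrite fx lee_fin zE//; move: srho; rewrite /rho; lra.
  by rewrite vz ltxx.
have tw : t * w <= rho.
  rewrite -(ler_pM2l s0); apply: le_trans (ltW d_lt).
  by rewrite mulrCA sw.
by apply: le_trans tw; rewrite ler_wpM2l// gerBl ltW.
Qed.

(** Although [f - phi] need not be weakly lower semicontinuous, convergence in
    the conjugate space keeps [phi (y n)] from exceeding [phi x] in the limit,
    so [f (y n)], which is close to [m + phi (y n)], is eventually less than any
    number above [m + phi x]. *)
Lemma weakly_lsc_min_attained p f phi x (y : nat -> X) (m : R) :
  dual_cone (conj_norm p) phi -> weakly_lsc_at p f x ->
  weak_cvg p y x -> weak_cvg (conj_norm p) y x ->
  (f (y n) - (phi (y n))%:E)%E @[n --> \oo] --> m%:E ->
  (f x - (phi x)%:E <= m%:E)%E.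
Proof.
move=> phid flsc /weak_cvgP yx /weak_cvg_ltP yx' gy.
rewrite leeBlDr// -EFinD leNgt; apply/negP => mfx.
have [a ma afx] : exists2 a : R, m + phi x < a & (a%:E < f x)%E.
  case: (f x) mfx => [r|_|//].
    by rewrite lte_fin => mr; exists ((m + phi x + r) / 2); rewrite ?lte_fin; lra.
  by exists (m + phi x + 1); rewrite ?ltry// ltrDl.
have e0 : 0 < (a - (m + phi x)) / 2 by rewrite divr_gt0// subr_gt0.
set e := (a - (m + phi x)) / 2 in e0.
have near_f : \forall n \near \oo, (a%:E < f (y n))%E by exact: yx (flsc a afx).
have near_phi := yx' _ phid _ e0.
have me : (m%:E < (m + e)%:E)%E by rewrite lte_fin ltrDl.
have near_g : \forall n \near \oo, (f (y n) - (phi (y n))%:E < (m + e)%:E)%E.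
  exact: (gy _ (open_ereal_lt' me)).
have [n [fn [pn gn]]] := filter_ex (filterI near_f (filterI near_phi near_g)).
rewrite (scalar_sub phid.1) in pn.
rewrite lteBlDr// -EFinD in gn.
have := lt_trans fn gn; move: pn; rewrite lte_fin /e; lra.
Qed.

Lemma right_gateaux_of_strong_min p f phi x :
  asymmetric_norm p -> convex_ereal f -> dual_cone (conj_norm p) phi ->
  f x \is a fin_num ->
  (f x - (phi x)%:E)%E = ereal_inf (range (fun z => f z - (phi z)%:E)%E) ->
  (forall y : nat -> X,
    (f (y n) - (phi (y n))%:E)%E @[n --> \oo] --> (f x - (phi x)%:E)%E ->
    weak_cvg (conj_norm p) y x) ->
  right_gateaux (conj_norm p) (convex_conjugate f) phi
    (fun psi : X -> R => psi x).
Proof.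
move=> pn fc phid ffin gx gy.
have gfin : (f x - (phi x)%:E)%E \is a fin_num by rewrite fin_numD ffin.
have fx : f x = (fine (f x))%:E by rewrite fineK.
set c := fine (f x) in fx.
have Fphi : convex_conjugate f phi = (phi x - c)%:E.
  by rewrite convex_conjugateE -gx fx -EFinB -EFinN opprB.
have gmin z : (f x - (phi x)%:E <= f z - (phi z)%:E)%E.
  by rewrite gx; apply: ereal_inf_lbound; exists z.
split; first by rewrite Fphi.
- by move=> a b psi1 psi2 _ _ _ _.
- exact: evaluation_cone_continuous (asymmetric_norm_conj pn).
move=> v vd.
apply: cvge0_of_bounds => e e0.
have [d d0 small] : exists2 d : R, 0 < d & forall z,
    (f z - (phi z)%:E <= f x - (phi x)%:E + d%:E)%E -> v (z - x) < e.
  apply: (@minimizing_seq_unif _ _ (fun z => f z - (phi z)%:E)%E x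
            [set z | v (z - x) < e]) => // y /gy /weak_cvg_ltP yx.
  exact: yx.
near=> t.
have t0 : 0 < t by near: t; exact: nbhs_right_gt.
have ted : t * e <= d.
  by rewrite -ler_pdivlMr//; near: t; apply: nbhs_right_le; rewrite divr_gt0.
have := conjugate_le_of_strong_min fc phid.1 vd.1 fx gmin d0 e0 small (ltW t0) ted.
have := convex_conjugate_ge f (phi \+ t \*o v) x.
rewrite Fphi fx.
case: (convex_conjugate f _) => [a lo hi|_|]; last 2 first.
- by rewrite leye_eq.
- by rewrite leeNy_eq.
have {}lo : phi x + t * v x - c <= a by rewrite -lee_fin.
have {}hi : a <= phi x - c + t * (v x + e) by rewrite -lee_fin.
rewrite -!EFinB -EFinM !lee_fin mulr_ge0 ?invr_ge0 ?(ltW t0)//=; last by lra.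
by rewrite mulrC ler_pdivrMr//; lra.
Unshelve. all: by end_near.
Qed.

End Differentiability.

(** * The equivalence *)

Theorem theorem4p1 (R : realType) (X : lmodType R) (p : X -> R)
    (f : X -> \bar R) (x : X) (phi : X -> R) :
  asymmetric_norm p -> proper_fun f -> dual_cone (conj_norm p) phi ->
  let g := fun z : X => (f z - (phi z)%:E)%E in
  let statement_i :=
    [/\ weakly_lsc_at p f x,
        right_gateaux (conj_norm p) (convex_conjugate f) phi
          (fun psi : X -> R => psi x) &
        exists y : nat -> X,
          (g (y n) @[n --> \oo] --> ereal_inf (range g)) /\
          weak_cvg p y x] in
  let statement_ii :=
    g x = ereal_inf (range g) /\
    forall y : nat -> X,
      g (y n) @[n --> \oo] --> g x -> weak_cvg (conj_norm p) y x in
  let statement_iii :=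
    f x \is a fin_num /\ biconjugate p f x = f x in
  [/\ statement_i -> statement_ii,
      statement_ii -> statement_iii &
      convex_ereal f -> (statement_i <-> statement_ii)].
Proof.
move=> pn [fN [x1 fx1]] phid g si sii siii.
have i_ii : si -> sii.
  move=> [flsc fdiff [y [gy yx]]].
  have [Ffin _ _ _] := fdiff.
  have gx : g x = ereal_inf (range g).
    apply/eqP; rewrite eq_le ereal_inf_lbound ?andbT; last by exists x.
    have infE : ereal_inf (range g) = (- fine (convex_conjugate f phi))%:E.
      by rewrite EFinN fineK// convex_conjugateE oppeK.
    rewrite infE; apply: (weakly_lsc_min_attained phid flsc yx).
      exact: minimizing_seq_weak_cvg fdiff gy.
    by rewrite -infE.
  split=> // z; rewrite gx; exact: minimizing_seq_weak_cvg fdiff.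
have min_fin : g x = ereal_inf (range g) -> f x \is a fin_num.
  move=> gx; have : (g x <= g x1)%E.
    by rewrite gx; apply: ereal_inf_lbound; exists x1.
  rewrite fin_numE fN /=; apply: contraTneq; rewrite /g => ->.
  by case: (f x1) (fN x1) fx1.
have ii_iii : sii -> siii.
  move=> [gx gy]; have ffin := min_fin gx; split=> //.
  apply/eqP; rewrite eq_le biconjugate_le//=.
  apply: le_trans (_ : ((phi x)%:E - convex_conjugate f phi <= _)%E); last first.
    by apply: ereal_sup_ubound; exists phi.
  by rewrite convex_conjugateE oppeK -gx /g addeC subeK.
split=> // fc; split=> // -[gx gy].
have ffin := min_fin gx.
split.
(* The minimum inequality f z >= f x + phi (z - x) makes the half-space
   - phi (z - x) < f x - a a neighbourhood on which f exceeds a. *)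
- move=> a afx.
  exists 1%N, (fun _ z => - phi z), (fine (f x) - a); split.
  + by rewrite subr_gt0 -lte_fin fineK.
  + by move=> _; exact: dual_coneN.
  + move=> z /= /(_ ord0); rewrite (scalar_sub phid.1) => phiz.
    have : (g x <= g z)%E by rewrite gx; apply: ereal_inf_lbound; exists z.
    rewrite /g -(fineK ffin); case: (f z) (fN z) => [r|_|//] _.
      by rewrite -!EFinB lee_fin lte_fin; lra.
    exact: ltry.
- exact: right_gateaux_of_strong_min gx gy.
- exists (fun=> x); split; first by rewrite gx; exact: cvg_cst.
  apply/weak_cvg_ltP => psi psid e e0.
  by apply: nearW => n; rewrite subrr (scalar0 psid.1).
Qed.
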